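(* Any border of a conjugate of a Christoffel word is a power of a conjugate of a Christoffel word.
   Context: Words are over $A=\{a,b\}$. A border of a word is a nonempty proper prefix which is also a suffix of this word. Two words $u,v$ are conjugate if $u=xy$, $v=yx$ for some words $x,y$. Write $(u,v)$ for the endomorphism of $A^*$ sending $a\mapsto u$, $b\mapsto v$, and let $G=(a,ab)$, $\widetilde G=(a,ba)$, $D=(ba,b)$, $\widetilde D=(ab,b)$. A lower (resp. upper) Christoffel word is the image of $a$ or $b$ under an element of the monoid of endomorphisms generated by $G$ and $\widetilde D$ (resp. by $\widetilde G$ and $D$). A Christoffel word is a lower or an upper Christoffel word. *)

(* Defs.v *)
From mathcomp Require Import all_boot.

Set Implicit Arguments.
Unset Strict Implicit.
Unset Printing Implicit Defensive.

(* The alphabet {a, b} is bool, with a = false and b = true. *)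
Notation letter := bool.
Notation a := (false : letter).
Notation b := (true : letter).

Notation word := (seq letter).

(* [subst u v] is the endomorphism (u, v) of the free monoid, sending
   a to u and b to v. *)
Definition subst (u v : word) (w : word) : word :=
  flatten [seq (if c == a then u else v) | c <- w].

Definition G : word -> word := subst [:: a] [:: a; b].
Definition Gt : word -> word := subst [:: a] [:: b; a].
Definition D : word -> word := subst [:: b; a] [:: b].
Definition Dt : word -> word := subst [:: a; b] [:: b].

Inductive generated (f g : word -> word) : (word -> word) -> Prop :=
| generated_id : generated f g id
| generated_l : generated f g f
| generated_r : generated f g g
| generated_comp h k :
    generated f g h -> generated f g k -> generated f g (h \o k).

Definition lower_christoffel (w : word) : Prop :=
  exists2 h, generated G Dt h & w = h [:: a] \/ w = h [:: b].

Definition upper_christoffel (w : word) : Prop :=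
  exists2 h, generated Gt D h & w = h [:: a] \/ w = h [:: b].

Definition christoffel (w : word) : Prop :=
  lower_christoffel w \/ upper_christoffel w.

Definition conjugate (u v : word) : Prop :=
  exists x y : word, u = x ++ y /\ v = y ++ x.

Definition border (u w : word) : bool :=
  [&& u != [::], u != w, prefix u w & suffix u w].

Definition power (u : word) (n : nat) : word := flatten (nseq n u).

(* Main.v *)
Require Import Defs.
From mathcomp Require Import all_boot.
From mathcomp Require Import zify.

(** Call a word circularly balanced when, in each of its powers, a factor
    holds at most one more b than any factor that is at least as long.  The
    nonempty circularly balanced words are exactly the powers, with a positive
    exponent, of conjugates of Christoffel words, and circular balance passes to borders for a
    reason that has nothing to do with Christoffel words.

    Balance passes to borders: if [u] is a border of [w], write
    [w = u s = p u]; then [w w = p u u s] contains the square [u u], so that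
    [u u] is balanced.  This is enough for all powers of [u] to be balanced
    ([cbalanced_square]), since a window of length [size u] in a power of [u]
    always holds the same number of b's, and lengths can thus be reduced
    below the period, where every factor of a power of [u] occurs in [u u].

    Christoffel words are circularly balanced ([cbalanced_christoffel]): [G]
    preserves balance, because a factor of [G s] comes from a factor [t] of
    [s] with as many b's and with a length known up to one
    ([balanced_G]).  The other generators follow from [G]: [Gt] gives a
    conjugate of [G], and [D], [Dt] are [G], [Gt] with the two letters
    exchanged.

    Conversely ([cbalanced_christoffel_power]), a circularly balanced word
    with both letters cannot contain both aa and bb circularly.  Up to
    exchanging the letters bb is missing, and then the word is conjugate to
    [G v] with [v] shorter and again circularly balanced; induction on the
    length ends at the powers of a letter. *)

Local Notation nb := (count (@id bool)).
Local Notation exchange := (map negb).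

(** * Morphisms, powers and the exchange of letters *)

Lemma subst_cat u v s t : subst u v (s ++ t) = subst u v s ++ subst u v t.
Proof. by rewrite /subst map_cat flatten_cat. Qed.

Lemma G_cons c s : G (c :: s) = (if c then [:: a; b] else [:: a]) ++ G s.
Proof. by case: c. Qed.

Lemma G_cat s t : G (s ++ t) = G s ++ G t.
Proof. exact: subst_cat. Qed.

Lemma powerS u n : power u n.+1 = u ++ power u n.
Proof. by []. Qed.

Lemma powerSr u n : power u n.+1 = power u n ++ u.
Proof.
by elim: n => [|n IHn]; rewrite powerS ?cats0 // {1}IHn powerS catA.
Qed.

Lemma subst_power u v s n : subst u v (power s n) = power (subst u v s) n.
Proof. by elim: n => // n IHn; rewrite !powerS subst_cat IHn. Qed.

Lemma map_power (f : letter -> letter) s n : map f (power s n) = power (map f s) n.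
Proof. by elim: n => // n IHn; rewrite !powerS map_cat IHn. Qed.

Lemma nseq_power c n : nseq n c = power [:: c] n.
Proof. by elim: n => // n IHn; rewrite powerS -IHn. Qed.

(** [infixP] with its witnesses typed as words rather than as sequences over
    the carrier of an [eqType], so that their sizes agree syntactically with
    the sizes of the other words. *)
Lemma infix_wordP (x s : word) :
  reflect (exists p q : word, s = p ++ x ++ q) (infix x s).
Proof. exact: infixP. Qed.

Lemma size_G s : size (G s) = size s + nb s.
Proof. by elim: s => // c s IHs; rewrite G_cons size_cat IHs; case: c => /=; lia. Qed.

Lemma nb_G s : nb (G s) = nb s.
Proof. by elim: s => // c s IHs; rewrite G_cons count_cat IHs; case: c. Qed.

Lemma nb_le_size (s : word) : nb s <= size s.
Proof. exact: count_size. Qed.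

Lemma nb_exchange s : nb (exchange s) + nb s = size s.
Proof. by elim: s => // -[] s /= <-; lia. Qed.

Lemma exchangeK : involutive exchange.
Proof. by apply: mapK; exact: negbK. Qed.

Lemma D_exchange s : D s = exchange (G (exchange s)).
Proof. by elim: s => // -[] s IHs; rewrite /D /G /subst /= in IHs *; rewrite IHs. Qed.

Lemma Dt_exchange s : Dt s = exchange (Gt (exchange s)).
Proof. by elim: s => // -[] s IHs; rewrite /Dt /Gt /subst /= in IHs *; rewrite IHs. Qed.

(** * Conjugacy *)

Lemma conjugate_refl u : conjugate u u.
Proof. by exists u, [::]; rewrite cats0. Qed.

Lemma conjugate_sym u v : conjugate u v -> conjugate v u.
Proof. by case=> x [y [-> ->]]; exists y, x. Qed.

Lemma conjugate_rot1 u v : conjugate u v -> conjugate u (rot 1 v).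
Proof.
case=> x [y [-> ->]]; case: y => [|c y].
  by case: x => [|c x]; [exists [::], [::] | exists [:: c], x; rewrite cats0 rot1_cons cats1].
exists (rcons x c), y; rewrite rot1_cons cat_rcons; split=> //.
by rewrite rcons_cat.
Qed.

(** Every conjugate is reached by moving one letter at a time, so a property
    is invariant under conjugacy as soon as it survives [rot 1]. *)
Lemma conjugate_ind (P : word -> Prop) u v :
  (forall s, P s -> P (rot 1 s)) -> conjugate u v -> P u -> P v.
Proof.
move=> Prot [x [y [-> ->]]]; elim: x y => [|c x IHx] y; first by rewrite cats0.
by move/Prot; rewrite rot1_cons -cats1 -catA => /IHx; rewrite -catA.
Qed.

Lemma conjugate_trans u v w : conjugate u v -> conjugate v w -> conjugate u w.
Proof. by move=> uv vw; apply: conjugate_ind vw uv => s; apply: conjugate_rot1. Qed.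

Lemma conjugate_subst s t u v :
  conjugate u v -> conjugate (subst s t u) (subst s t v).
Proof.
by case=> x [y [-> ->]]; exists (subst s t x), (subst s t y); rewrite !subst_cat.
Qed.

Lemma conjugate_map (f : letter -> letter) u v :
  conjugate u v -> conjugate (map f u) (map f v).
Proof. by case=> x [y [-> ->]]; exists (map f x), (map f y); rewrite !map_cat. Qed.

Lemma cons_power_rot1 c t k :
  c :: power (rot 1 (c :: t)) k = power (c :: t) k ++ [:: c].
Proof.
elim: k => // k IHk; rewrite !powerS -catA -IHk.
by rewrite {1}rot1_cons -cat_cons -rcons_cons cat_rcons.
Qed.

Lemma rot1_power v n : rot 1 (power v n) = power (rot 1 v) n.
Proof.
case: n => [|n]; first by [].
case: v => [|c v]; first by rewrite /=; elim: n.
have := cons_power_rot1 c v n.+1.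
by rewrite [power (c :: v) _]powerS cat_cons [RHS]cat_cons !rot1_cons -!cats1 => -[<-].
Qed.

(** Both images satisfy [G w ++ a = a ++ Gt w], since this holds for the
    images ab and ba of the letter b. *)
Lemma conjugate_G_Gt w : conjugate (G w) (Gt w).
Proof.
have shift s : G s ++ [:: a] = a :: Gt s.
  elim: s => // c s IHs; rewrite G_cons -catA IHs.
  by case: c.
case: w => [|c w]; first exact: conjugate_refl.
have := shift (c :: w); case EG: (G (c :: w)) => [|d s]; first by case: (c) EG.
by case=> -> <-; exists [:: a], s.
Qed.

Lemma conjugate_D_Dt w : conjugate (D w) (Dt w).
Proof.
by rewrite D_exchange Dt_exchange; apply: conjugate_map; apply: conjugate_G_Gt.
Qed.

(** * Balanced words *)

(** Comparing with all factors [y] that are at least as long, and not only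
    with those of the same length, is equivalent (cut [y]) and spares the
    later arguments any adjustment of lengths. *)
Definition balanced (s : word) : Prop :=
  forall x y : word, infix x s -> infix y s -> size x <= size y -> nb x <= nb y + 1.

Definition cbalanced (w : word) : Prop := forall k, balanced (power w k).

Lemma balanced_infix s t : infix s t -> balanced t -> balanced s.
Proof.
by move=> st bt x y xs ys; apply: bt; [apply: infix_trans xs st | apply: infix_trans ys st].
Qed.

(** The part of [x] that sticks out beyond the length of [y] adds at most its
    own length. *)
Lemma balanced_excess s x y : balanced s -> infix x s -> infix y s ->
  nb x <= nb y + 1 + (size x - size y).
Proof.
move=> bs xs ys; rewrite -{1}(cat_take_drop (size y) x) count_cat.
apply: leq_add; last by rewrite -size_drop nb_le_size.
apply: bs => //; first exact: infix_trans (infix_take _ _) xs.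
by rewrite size_take; case: ltnP.
Qed.

Lemma balanced_nseq c k : balanced (nseq k c).
Proof.
move=> x y xk yk sxy.
have nby (z : word) : infix z (nseq k c) -> nb z = c * size z.
  move=> /mem_infix zc; have /all_pred1P-> : all (pred1 c) z.
    by apply/allP=> d /zc /nseqP[-> _] /=.
  by rewrite count_nseq size_nseq.
by rewrite !nby //; case: c {nby xk yk}; lia.
Qed.

(** The number of a's is the length minus the number of b's, so a comparison
    of [x] with a longer [y] turns into a comparison of [y] with the shorter
    [x], which is what [balanced_excess] bounds. *)
Lemma balanced_exchange s : balanced s -> balanced (exchange s).
Proof.
move=> bs x y.
have infixE (z : word) : infix z (exchange s) -> infix (exchange z) s.
  case/infix_wordP=> [p [q Es]]; apply/infix_wordP; exists (exchange p), (exchange q).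
  by rewrite -!map_cat -Es exchangeK.
move=> /infixE xs /infixE ys sxy.
have := balanced_excess s _ _ bs ys xs.
by rewrite !size_map; have := nb_exchange x; have := nb_exchange y; lia.
Qed.

Lemma G_split (s p q : word) : G s = p ++ q ->
  exists t s' : word, s = t ++ s' /\
    ((p = G t /\ q = G s') \/
     exists2 s'', s' = b :: s'' & p = G t ++ [:: a] /\ q = b :: G s'').
Proof.
elim: s p q => [|c s IHs] p q.
  by case: p q => [|//] [|//] _; exists [::], [::]; split=> //; left.
case: p => [|c0 p]; first by move=> /esym Eq; exists [::], (c :: s); split=> //; left.
rewrite G_cons; case: c => /= -[<-].
- case: p => [/= <-|c1 p [<- /IHs[t [s' [-> H]]]]].
    by exists [::], (b :: s); split=> //; right; exists s.
  exists (b :: t), s'; split=> //.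
  by case: H => [[-> ->]|[s'' -> [-> ->]]]; [left | right; exists s''].
- move=> /IHs[t [s' [-> H]]]; exists (a :: t), s'; split=> //.
  by case: H => [[-> ->]|[s'' -> [-> ->]]]; [left | right; exists s''].
Qed.

(** A factor [x] of [G s] may begin with the second letter of an image ab
    or end with the first one.  Taking into [t] the letter b in the former
    case but not in the latter preserves the number of b's; both ends together
    then shift the length by at most one. *)
Lemma G_infix s (x : word) : infix x (G s) -> exists2 t : word, infix t s &
  [/\ nb t = nb x, size t + nb x <= size x + 1 & size x <= size t + nb x + 1].
Proof.
case/infix_wordP=> p [q /G_split[t [s' [-> []]]]].
- case=> _ /esym/G_split[t1 [s1 [-> []]]].
    by case=> -> _; exists t1; [exact: infix_infix | rewrite size_G nb_G; split; lia].
  case=> s2 -> [-> _]; exists t1; first exact: infix_infix.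
  by rewrite size_cat count_cat size_G nb_G /=; split; lia.
- case=> s'' -> [_]; case: x => [|c x] /=.
    by exists [::]; [exact: infix0s | split].
  case=> -> /esym/G_split[t1 [s1 [-> []]]].
    by case=> -> _; exists (b :: t1); [exact: infix_infix | rewrite /= size_G nb_G; split; lia].
  case=> s2 -> [-> _]; exists (b :: t1); first exact: infix_infix.
  by rewrite /= size_cat count_cat size_G nb_G /=; split; lia.
Qed.

(** By [G_infix], two b's more in [x] than in a longer [y] would give
    preimages with the same excess, and the one of [x] would still be no
    longer than the one of [y]: each b costs one letter of the preimage. *)
Lemma balanced_G s : balanced s -> balanced (G s).
Proof.
move=> bs x y /G_infix[t ts [<- ? ?]] /G_infix[t' t's [<- ? ?]] ?.
have := bs t t' ts t's; lia.
Qed.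

Lemma cbalanced_letter c : cbalanced [:: c].
Proof. by move=> k; rewrite -nseq_power; apply: balanced_nseq. Qed.

Lemma cbalanced_conjugate u v : conjugate u v -> cbalanced u -> cbalanced v.
Proof.
apply: conjugate_ind => -[|c t] // bs k; apply: balanced_infix (bs k.+1).
rewrite powerSr (_ : _ ++ _ = (c :: power (rot 1 (c :: t)) k) ++ t).
  by rewrite infix_catr // infix_cons.
by rewrite cons_power_rot1 -catA.
Qed.

Lemma cbalanced_exchange w : cbalanced w -> cbalanced (exchange w).
Proof. by move=> bw k; rewrite -map_power; apply: balanced_exchange. Qed.

Lemma cbalanced_G w : cbalanced w -> cbalanced (G w).
Proof. by move=> bw k; rewrite -subst_power; apply: balanced_G. Qed.

Lemma cbalanced_Gt w : cbalanced w -> cbalanced (Gt w).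
Proof. by move/cbalanced_G; apply: cbalanced_conjugate; apply: conjugate_G_Gt. Qed.

Lemma cbalanced_christoffel c : christoffel c -> cbalanced c.
Proof.
have D_ok w : cbalanced w -> cbalanced (D w).
  move/cbalanced_exchange/cbalanced_G/cbalanced_exchange.
  by rewrite D_exchange.
have Dt_ok w : cbalanced w -> cbalanced (Dt w).
  by move/D_ok; apply: cbalanced_conjugate; apply: conjugate_D_Dt.
have gen f g h : (forall w, cbalanced w -> cbalanced (f w)) ->
    (forall w, cbalanced w -> cbalanced (g w)) -> generated f g h ->
    forall w, cbalanced w -> cbalanced (h w).
  by move=> f_ok g_ok; elim=> // {}h k _ IHh _ IHk w /IHk/IHh.
case=> -[h].
  by move/(gen _ _ _ cbalanced_G Dt_ok) => h_ok [] ->; apply/h_ok/cbalanced_letter.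
by move/(gen _ _ _ cbalanced_Gt D_ok) => h_ok [] ->; apply/h_ok/cbalanced_letter.
Qed.

(** * Squares and borders *)

(** The prefix and the suffix [u] meet in the middle of [w ++ w]. *)
Lemma border_square u w : border u w -> infix (u ++ u) (w ++ w).
Proof.
case/and4P=> _ _ /prefixP[s ws] /suffixP[p wp].
by rewrite {1}wp ws -catA (catA u u s) infix_infix.
Qed.

Lemma infix_power_square (u x : word) k :
  infix x (power u k) -> size x <= size u -> infix x (u ++ u).
Proof.
(* Drop whole copies of u until x starts within the first one; then it ends
   within the first two. *)
elim: k => [|k IHk]; first by rewrite infixs0 => /eqP->; rewrite infix0s.
case/infix_wordP=> p [q]; rewrite powerS => e sx.
have [up|pu] := leqP (size u) (size p).
  apply: IHk sx; move/(congr1 (drop (size u))): e.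
  rewrite [LHS]drop_size_cat // -(cat_take_drop (size u) p) -catA drop_size_cat.
    by move=> ->; rewrite infix_infix.
  by rewrite size_takel.
have: prefix (p ++ x) (u ++ power u k) by rewrite e catA prefix_prefix.
case: k {IHk} e => [|k] e; first by rewrite cats0 => /prefixW/catl_infix/infix_catr.
rewrite powerS catA => px; suff: prefix (p ++ x) (u ++ u) by move/prefixW/catl_infix.
move: px; rewrite !prefixE take_cat size_cat; case: ltnP => //.
rewrite size_cat => le /eqP; rewrite -size_cat in le.
have -> : size p + size x - (size u + size u) = 0 by lia.
by rewrite take0 cats0 => <-; rewrite take_oversize // size_cat.
Qed.

Lemma nb_period (u x : word) k :
  infix x (power u k) -> size x = size u -> nb x = nb u.
Proof.
move=> xk sx; have := infix_power_square u x k xk; rewrite sx leqnn => /(_ isT).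
case/infix_wordP=> p [q e].
have pu : size p <= size u by move/(congr1 size): e; rewrite !size_cat; lia.
(* x is a window of length |u| in u u: removing it leaves a prefix p and a
   suffix q that make up one copy of u. *)
have ep : take (size p) u = p.
  by move/(congr1 (take (size p))): e; rewrite [RHS]take_size_cat // takel_cat.
have eq : drop (size p) u = q.
  move/(congr1 (drop (size p + size u))): e.
  by rewrite catA [RHS]drop_size_cat ?size_cat ?sx // -drop_drop drop_size_cat.
have nu : nb u = nb p + nb q by rewrite -[in LHS](cat_take_drop (size p) u) ep eq count_cat.
by move/(congr1 nb): e; rewrite !count_cat nu; lia.
Qed.

(** Two factors longer than the period [size u] both lose the same number of
    b's when their first [size u] letters are removed; two factors within the
    period already occur in [u ++ u]. *)
Lemma cbalanced_square u : balanced (u ++ u) -> cbalanced u.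
Proof.
move=> bu k x; have [n] := ubnP (size x); elim: n x => // n IHn x lexn y xk yk sxy.
have tk (z : word) : infix z (power u k) -> infix (take (size u) z) (power u k).
  exact/infix_trans/infix_take.
have [xu|ux] := leqP (size x) (size u).
  have yt : infix (take (size x) y) (power u k) by apply: infix_trans yk; apply: infix_take.
  have := bu x (take (size x) y) (infix_power_square _ _ _ xk xu).
  rewrite size_takel // (infix_power_square _ _ _ yt) ?size_takel // => /(_ isT (leqnn _)).
  by rewrite -{2}(cat_take_drop (size x) y) count_cat; lia.
have [u0|u0] := posnP (size u).
  move: xk; rewrite (size0nil u0) (_ : power [::] k = [::]) ?infixs0; last by elim: (k).
  by move/eqP->.
have dk (z : word) : infix z (power u k) -> infix (drop (size u) z) (power u k).
  exact/infix_trans/infix_drop.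
have per (z : word) : infix z (power u k) -> size u <= size z ->
    nb z = nb u + nb (drop (size u) z).
  move=> zk uz; rewrite -{1}(cat_take_drop (size u) z) count_cat.
  by rewrite (nb_period u _ k (tk z zk)) // size_takel.
rewrite (per x xk (ltnW ux)) (per y yk); last lia.
by rewrite -addnA leq_add2l; apply: IHn; rewrite ?size_drop ?dk //; lia.
Qed.

(** A word without bb that starts with a factors into blocks a and ab.  The
    induction needs both claims: before a word [b :: s] the new a forms a
    block ab with this b, so that it is [s] itself that must be an image. *)
Lemma no_bb_image_G (s : word) : ~~ infix [:: b; b] s ->
  (exists t, a :: s = G t) /\ (head a s = a -> exists t, s = G t).
Proof.
elim: s => [|c s IHs] nbb; first by split; [exists [:: a] | exists [::]].
have /IHs[[t st] IHh] : ~~ infix [:: b; b] s.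
  by apply: contra nbb; move=> h; apply: infix_trans h _; exact: infix_cons.
case: c nbb => nbb; last first.
  by split=> [|_]; [exists (a :: t); rewrite st | exists t].
split=> //; have [|t' ->] := IHh; last by exists (b :: t').
by case: s nbb {IHs IHh st} => // -[] s //=; rewrite prefix0s.
Qed.

(** Let [x] hold at least two b's more than the longer [y].  The image [G x]
    starts with a, which is dropped, and [G y] is always followed by a, which
    is added: this shortens the one, lengthens the other and changes no count
    of b's.  With [size (G x) = size x + nb x] the excess of b's then
    contradicts [balanced_excess]. *)
Lemma cbalanced_of_G v : cbalanced (G v) -> cbalanced v.
Proof.
move=> bGv k x y xk yk sxy; rewrite leqNgt; apply/negP => lt.
(* The extra copy of v provides the letter a that follows G y. *)
have bG : balanced (G (power v k.+1)) by rewrite /G subst_power; apply: bGv.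
have v0 : G v = a :: behead (G v).
  case: v xk {yk bGv bG} => [|[] v] // xk; suff x0 : x = [::] by rewrite x0 in lt.
  by apply/eqP; rewrite -infixs0; move: xk; rewrite (_ : power _ _ = [::]) //; elim: (k).
have hx : G x = a :: behead (G x) by case: x lt {xk sxy} => [|[] x].
have gx : infix (behead (G x)) (G (power v k.+1)).
  case/infix_wordP: xk => p [q e]; rewrite powerSr e.
  rewrite !G_cat -!catA hx; apply: infix_catl; apply: infix_trans (infix_cons _ _).
  exact: prefix_infix.
have gy : infix (G y ++ [:: a]) (G (power v k.+1)).
  case/infix_wordP: yk => p [q e]; rewrite powerSr e !G_cat -!catA; apply: infix_catl.
  have -> : G q ++ G v = a :: behead (G q ++ G v).
    by rewrite v0; case: (q) => [|[] ?].
  by rewrite cats1 -cat_rcons prefix_infix.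
have := balanced_excess _ _ _ bG gx gy.
have := size_G x; have := nb_G x; rewrite hx /= size_cat count_cat size_G nb_G /=.
lia.
Qed.

(** * Desubstitution *)

Definition christoffel_power (u : word) : Prop :=
  exists d v n,
    [/\ lower_christoffel d, conjugate d v, 0 < n & u = power v n].

Lemma christoffel_power_conjugate u v :
  conjugate u v -> christoffel_power u -> christoffel_power v.
Proof.
apply: conjugate_ind => _ [d [v' [n [ld dv n0 ->]]]].
by exists d, (rot 1 v'), n; split; rewrite ?rot1_power //; apply: conjugate_rot1.
Qed.

Lemma christoffel_power_G u : christoffel_power u -> christoffel_power (G u).
Proof.
case=> d [v [n [[h gh hd] dv n0 ->]]]; exists (G d), (G v), n.
rewrite -subst_power; split=> //; last exact: conjugate_subst.
exists (G \o h); last by case: hd => ->; [left | right].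
by apply: generated_comp gh; apply: generated_l.
Qed.

(** [Dt], not [D], generates the lower Christoffel words, but the two images
    are conjugate. *)
Lemma christoffel_power_D u : christoffel_power u -> christoffel_power (D u).
Proof.
case=> d [v [n [[h gh hd] dv n0 ->]]]; exists (Dt d), (D v), n.
rewrite -subst_power; split=> //.
  exists (Dt \o h); last by case: hd => ->; [left | right].
  by apply: generated_comp gh; apply: generated_r.
apply: conjugate_trans (conjugate_subst _ _ _ _ dv).
exact/conjugate_sym/conjugate_D_Dt.
Qed.

Lemma christoffel_power_nseq c n : 0 < n -> christoffel_power (nseq n c).
Proof.
move=> n0; exists [:: c], [:: c], n; split=> //; [|exact: conjugate_refl|exact: nseq_power].
by exists id; [exact: generated_id | case: c; [right | left]].
Qed.

Lemma no_bb_conjugate_G u : a \in u -> ~~ infix [:: b; b] (u ++ u) ->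
  exists v, conjugate u (G v).
Proof.
move=> /rot_to[i s e] nbb.
have [t st] : exists t, a :: s = G t.
  apply: (proj1 (no_bb_image_G s _)); apply: contra nbb => /infix_trans; apply.
  have: infix (rot i u) (u ++ u).
    by rewrite /rot -{3 4}(cat_take_drop i u) -catA (catA (drop i u)) infix_infix.
  by rewrite e; apply: consl_infix.
by exists t; rewrite -st -e; exists (take i u), (drop i u); rewrite cat_take_drop.
Qed.

Lemma cbalanced_christoffel_power u :
  u != [::] -> cbalanced u -> christoffel_power u.
Proof.
have [n] := ubnP (size u); elim: n u => // n IHn u leun u0 bu.
have desubst (w : word) : size w = size u -> a \in w -> b \in w ->
    ~~ infix [:: b; b] (w ++ w) -> cbalanced w ->
    exists v, [/\ conjugate w (G v), cbalanced v, v != [::] & size v < n].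
  move=> sw aw bw nbb cw; have [v wv] := no_bb_conjugate_G w aw nbb.
  have pw : perm_eq w (G v) by case: wv => x [y [-> ->]]; rewrite perm_catC.
  exists v; split=> //.
  - exact/cbalanced_of_G/(cbalanced_conjugate _ _ wv).
  - by apply: contraL aw => /eqP v0; rewrite (perm_mem pw) v0.
  have : 0 < nb (G v).
    by rewrite -has_count; apply/hasP; exists b; rewrite -?(perm_mem pw).
  by rewrite nb_G; have := size_G v; rewrite -(perm_size pw) sw; lia.
have [au|na] := boolP (a \in u); last first.
  have /all_pred1P-> : all (pred1 b) u.
    by apply/allP=> -[] // ua; rewrite ua in na.
  by apply: christoffel_power_nseq; rewrite lt0n size_eq0.
have [bu'|nb'] := boolP (b \in u); last first.
  have /all_pred1P-> : all (pred1 a) u.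
    by apply/allP=> -[] // ub; rewrite ub in nb'.
  by apply: christoffel_power_nseq; rewrite lt0n size_eq0.
have [bb|nbb] := boolP (infix [:: b; b] (u ++ u)); last first.
  have [v [uv cv v0 sv]] := desubst u erefl au bu' nbb bu.
  apply: christoffel_power_conjugate (conjugate_sym _ _ uv) _.
  by apply: christoffel_power_G; apply: IHn.
have naa : ~~ infix [:: a; a] (u ++ u).
  apply/negP=> aa; have := bu 2 [:: b; b] [:: a; a].
  by rewrite /power /= cats0 => /(_ bb aa isT).
have mem_E c : (c \in exchange u) = (~~ c \in u).
  by rewrite -{1}[c]negbK mem_map //; apply: negb_inj.
have [|||||v [uv cv v0 sv]] := desubst (exchange u); rewrite ?size_map ?mem_E //.
- apply: contra naa => /infix_wordP[p [q e]]; apply/infix_wordP; exists (exchange p), (exchange q).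
  by rewrite -[LHS]exchangeK map_cat e !map_cat.
- exact: cbalanced_exchange.
have Ev : conjugate u (D (exchange v)).
  by rewrite D_exchange exchangeK -[u]exchangeK; apply: conjugate_map.
apply: christoffel_power_conjugate (conjugate_sym _ _ Ev) _.
apply: christoffel_power_D; apply: IHn; rewrite ?size_map //.
  by case: (v) v0.
exact: cbalanced_exchange.
Qed.

Theorem corollary8p2 (c w u : word)
  (hc : christoffel c) (hw : conjugate c w) (hu : border u w) :
  exists (d v : word) (n : nat),
    [/\ christoffel d, conjugate d v, 0 < n & u = power v n].
Proof.
have cw : cbalanced w by apply: cbalanced_conjugate hw (cbalanced_christoffel c hc).
have cu : cbalanced u.
  apply: cbalanced_square; apply: balanced_infix (border_square u w hu) _.
  by have := cw 2; rewrite /power /= cats0.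
have u0 : u != [::] by case/and4P: hu.
have [d [v [n [ld dv n0 uv]]]] := cbalanced_christoffel_power u u0 cu.
by exists d, v, n; split=> //; left.
Qed.
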